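(* Let $\mathcal{X}$ be a finite nonempty set. The weak-$\ast$ topology on $\mathrm{DMC}_{\mathcal{X},\ast}^{(o)}$ is the same as the noisiness topology $\mathcal{T}_{\mathcal{X},\ast}^{(o)}$.
   Context: For finite nonempty sets $\mathcal{X},\mathcal{Y}$, $\mathrm{DMC}_{\mathcal{X},\mathcal{Y}}$ is the set of channels from $\mathcal{X}$ to $\mathcal{Y}$, i.e. functions $W:\mathcal{X}\times\mathcal{Y}\to[0,1]$, written $W(y|x)$, with $\sum_{y\in\mathcal{Y}}W(y|x)=1$ for every $x\in\mathcal{X}$. For $W\in\mathrm{DMC}_{\mathcal{X},\mathcal{Y}}$ and $V\in\mathrm{DMC}_{\mathcal{Y},\mathcal{Z}}$, $V\circ W\in\mathrm{DMC}_{\mathcal{X},\mathcal{Z}}$ is $(V\circ W)(z|x)=\sum_{y\in\mathcal{Y}}V(z|y)W(y|x)$. A channel $W'\in\mathrm{DMC}_{\mathcal{X},\mathcal{Z}}$ is degraded from $W\in\mathrm{DMC}_{\mathcal{X},\mathcal{Y}}$ if $W'=V\circ W$ for some $V\in\mathrm{DMC}_{\mathcal{Y},\mathcal{Z}}$; $W$ and $W'$ are equivalent if each is degraded from the other. Let $[n]=\{1,\dots,n\}$, $\mathrm{DMC}_{\mathcal{X},\ast}=\coprod_{n\ge1}\mathrm{DMC}_{\mathcal{X},[n]}$, and let $\mathrm{DMC}_{\mathcal{X},\ast}^{(o)}$ be the quotient set of $\mathrm{DMC}_{\mathcal{X},\ast}$ by equivalence of channels. Noisiness topology. For $m\ge1$,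 let $\Delta_{[m]\times\mathcal{X}}$ be the set of probability distributions on $[m]\times\mathcal{X}$. For $p\in\Delta_{[m]\times\mathcal{X}}$ and $W\in\mathrm{DMC}_{\mathcal{X},\mathcal{Y}}$ let $$P_c(p,W)=\sup_{D\in\mathrm{DMC}_{\mathcal{Y},[m]}}\ \sum_{u\in[m],\,x\in\mathcal{X},\,y\in\mathcal{Y}}p(u,x)W(y|x)D(u|y).$$ $P_c(p,W)$ depends on $W$ only through its equivalence class, so $P_c(p,\hat W)$ is defined for $\hat W\in\mathrm{DMC}_{\mathcal{X},\ast}^{(o)}$. It is a known fact (Buscemi) that two channels $W,W'$ with input alphabet $\mathcal{X}$ are equivalent if and only if $P_c(p,W)=P_c(p,W')$ for all $m\ge 1$ and all $p\in\Delta_{[m]\times\mathcal{X}}$. The noisiness topology $\mathcal{T}_{\mathcal{X},\ast}^{(o)}$ is the topology induced by the metric $d_{\mathcal{X},\ast}^{(o)}(\hat W_1,\hat W_2)=\sup_{m\ge1,\,p\in\Delta_{[m]\times\mathcal{X}}}|P_c(p,\hat W_1)-P_c(p,\hat W_2)|$ on $\mathrm{DMC}_{\mathcal{X},\ast}^{(o)}$. Weak-$\ast$ topology. Let $\Delta_{\mathcal{X}}\subset\mathbb{R}^{\mathcal{X}}$ be the simplex of probability distributions on $\mathcal{X}$ with its Euclidean topology, and $\mathcal{MP}(\mathcal{X})$ the set of Borel probability measures on $\Delta_{\mathcal{X}}$. The weak-$\ast$ topology on $\mathcal{MP}(\mathcal{X})$ is the coarsest topology making $P\mapsto\int_{\Delta_{\mathcal{X}}}f\,dP$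 continuous for every bounded continuous $f:\Delta_{\mathcal{X}}\to\mathbb{R}$. A measure $M\in\mathcal{MP}(\mathcal{X})$ is balanced if $\int_{\Delta_{\mathcal{X}}}p\,dM(p)$ is the uniform distribution on $\mathcal{X}$; $\mathcal{MP}_{bf}(\mathcal{X})$ is the set of balanced measures with finite support. For $W\in\mathrm{DMC}_{\mathcal{X},\mathcal{Y}}$, put $P_W^o(y)=\frac1{|\mathcal{X}|}\sum_{x}W(y|x)$, $\mathrm{Im}(W)=\{y:P_W^o(y)>0\}$, and for $y\in\mathrm{Im}(W)$ let $W_y^{-1}\in\Delta_{\mathcal{X}}$ be $W_y^{-1}(x)=W(y|x)/(|\mathcal{X}|P_W^o(y))$. The Blackwell measure of $W$ is $\mathrm{MP}_W=\sum_{y\in\mathrm{Im}(W)}P_W^o(y)\,\delta_{W_y^{-1}}$. It is known that two channels with input alphabet $\mathcal{X}$ are equivalent if and only if they have the same Blackwell measure, and that the Blackwell measures are exactly the elements of $\mathcal{MP}_{bf}(\mathcal{X})$; hence the map sending a class to its Blackwell measure is a bijection from $\mathrm{DMC}_{\mathcal{X},\ast}^{(o)}$ to $\mathcal{MP}_{bf}(\mathcal{X})$. The weak-$\ast$ topology on $\mathrm{DMC}_{\mathcal{X},\ast}^{(o)}$ is obtained by transporting through this bijection the subspace topology of $\mathcal{MP}_{bf}(\mathcal{X})$ in $\mathcal{MP}(\mathcal{X})$ with the weak-$\ast$ topology. *)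

(* Defs.v *)
From HB Require Import structures.
From mathcomp Require Import all_boot all_order all_algebra generic_quotient ring lra.
From mathcomp Require Import all_classical all_reals all_analysis.
From mathcomp Require Import measurable_realfun.
Import Order.TTheory GRing.Theory Num.Theory.
Import numFieldTopology.Exports numFieldNormedType.Exports.

Set Implicit Arguments.
Unset Strict Implicit.
Unset Printing Implicit Defensive.

Local Open Scope classical_set_scope.
Local Open Scope ring_scope.
Local Open Scope quotient_scope.

(* The alphabet [n] with n >= 1 is encoded as 'I_k.+1 with k = n - 1. *)

(* [W x y] is W(y|x). *)
Definition is_channel (R : realType) (X Y : finType) (W : X -> Y -> R) : bool :=
  [forall x, forall y, 0 <= W x y <= 1] && [forall x, \sum_y W x y == 1].

Record channel (R : realType) (X Y : finType) := Channel {
  channel_fun :> X -> Y -> R ;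
  channelP : is_channel channel_fun }.

HB.instance Definition _ (R : realType) (X Y : finType) :=
  [isSub for @channel_fun R X Y].
HB.instance Definition _ (R : realType) (X Y : finType) :=
  [Choice of channel R X Y by <:].

Section channel_theory.
Context {R : realType}.
Implicit Types X Y Z : finType.

Lemma channel_ge0 X Y (W : channel R X Y) x y : 0 <= W x y.
Proof. by case/andP: (channelP W) => /forallP/(_ x)/forallP/(_ y)/andP[]. Qed.

Lemma channel_sum1 X Y (W : channel R X Y) x : \sum_y W x y = 1.
Proof. by case/andP: (channelP W) => _ /forallP/(_ x)/eqP. Qed.

Lemma is_channelP X Y (W : X -> Y -> R) :
  (forall x y, 0 <= W x y) -> (forall x, \sum_y W x y = 1) -> is_channel W.
Proof.
move=> W0 W1; apply/andP; split; apply/forallP => x; last exact/eqP/W1.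
apply/forallP => y; rewrite W0 /= -(W1 x) (bigD1 y)//= lerDl.
by apply: sumr_ge0.
Qed.

Lemma channel_ext X Y (W W' : channel R X Y) :
  (forall x y, W x y = W' x y) -> W = W'.
Proof.
by move=> WW'; apply: val_inj; apply/funext => x; apply/funext => y; exact: WW'.
Qed.

Definition comp_fun X Y Z (V : channel R Y Z) (W : channel R X Y) :=
  fun x z => \sum_y V y z * W x y.

Lemma comp_is_channel X Y Z (V : channel R Y Z) (W : channel R X Y) :
  is_channel (comp_fun V W).
Proof.
apply: is_channelP => [x z|x].
  by apply: sumr_ge0 => y _; rewrite mulr_ge0// channel_ge0.
rewrite exchange_big /= -[RHS](channel_sum1 W x); apply: eq_bigr => y _.
by rewrite -mulr_suml channel_sum1 mul1r.
Qed.

Definition channel_comp X Y Z (V : channel R Y Z) (W : channel R X Y) :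
  channel R X Z := Channel (comp_is_channel V W).

Lemma id_is_channel X : is_channel (fun x y : X => (x == y)%:R : R).
Proof.
apply: is_channelP => [x y|x]; first exact: ler0n.
by rewrite (bigD1 x)//= eqxx big1 ?addr0// => y; rewrite eq_sym => /negPf ->.
Qed.

Definition channel_id X : channel R X X := Channel (id_is_channel X).

Definition degraded X Y Z (W' : channel R X Z) (W : channel R X Y) : Prop :=
  exists V : channel R Y Z, W' = channel_comp V W.

Definition channel_equiv X Y Z (W : channel R X Y) (W' : channel R X Z) : Prop :=
  degraded W W' /\ degraded W' W.

Lemma degraded_refl X Y (W : channel R X Y) : degraded W W.
Proof.
exists (channel_id Y); apply: channel_ext => x z /=.
rewrite /comp_fun (bigD1 z)//= eqxx mul1r big1 ?addr0//.
by move=> y /negPf yz; rewrite yz mul0r.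
Qed.

Lemma degraded_trans X Y Y' Z (W : channel R X Y) (W' : channel R X Y')
    (W'' : channel R X Z) :
  degraded W'' W' -> degraded W' W -> degraded W'' W.
Proof.
move=> [V ->] [U ->]; exists (channel_comp V U).
apply: channel_ext => x z /=; rewrite /comp_fun/= /comp_fun.
under eq_bigr do rewrite mulr_sumr.
under [RHS]eq_bigr do rewrite mulr_suml.
by rewrite exchange_big /=; do 2 (apply: eq_bigr => ? _); rewrite mulrA.
Qed.

End channel_theory.

Definition DMC_star (R : realType) (X : finType) : Type :=
  {k : nat & channel R X 'I_k.+1}.

HB.instance Definition _ (R : realType) (X : finType) :=
  Choice.copy (DMC_star R X) {k : nat & channel R X 'I_k.+1}.

Section quotient.
Variables (R : realType) (X : finType).

Definition star_equiv (W W' : DMC_star R X) : bool :=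
  `[< channel_equiv (projT2 W) (projT2 W') >].

Lemma star_equiv_is_equiv : equiv_class_of star_equiv.
Proof.
split=> [W|W W'|W W' W''].
- by apply/asboolP; split; exact: degraded_refl.
- by apply/asboolP/asboolP => -[? ?]; split.
- move=> /asboolP[a b] /asboolP[c d]; apply/asboolP.
  by split; [apply: degraded_trans a c|apply: degraded_trans d b].
Qed.

Canonical star_equiv_rel := EquivRelPack star_equiv_is_equiv.

Definition DMCo : Type := {eq_quot star_equiv}.
HB.instance Definition _ := Choice.on DMCo.
HB.instance Definition _ := EqQuotient.on DMCo.

End quotient.

(* R^T carries the product topology, which is the Euclidean one as T is finite. *)
Definition prob_vectors (R : realType) (T : finType) : set {ptws T -> R} :=
  [set p | (forall t, 0 <= p t) /\ \sum_t p t = 1].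
Arguments prob_vectors : clear implicits.

Definition simplex (R : realType) (T : finType) : Type :=
  set_type (prob_vectors R T).

Definition simplex_fun (R : realType) (T : finType) (p : simplex R T) : T -> R :=
  \val p.
Coercion simplex_fun : simplex >-> Funclass.

Section noisiness.
Context {R : realType}.
Implicit Types (X Y Z T : finType) (m : nat).

Lemma simplex_ge0 T (p : simplex R T) t : 0 <= p t.
Proof. by case: (set_valP p) => p0 _; exact: p0. Qed.

Lemma simplex_sum1 T (p : simplex R T) : \sum_t p t = 1.
Proof. by case: (set_valP p). Qed.

Definition success_prob X Y m (p : simplex R ('I_m.+1 * X)%type)
    (W : channel R X Y) (D : channel R Y 'I_m.+1) : R :=
  \sum_u \sum_x \sum_y p (u, x) * W x y * D y u.

Definition Pc X Y m (p : simplex R ('I_m.+1 * X)%type) (W : channel R X Y) : R :=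
  sup [set success_prob p W D | D in [set: channel R Y 'I_m.+1]].

Lemma success_prob_ge0 X Y m p (W : channel R X Y) (D : channel R Y 'I_m.+1) :
  0 <= success_prob p W D.
Proof.
apply: sumr_ge0 => u _; apply: sumr_ge0 => x _; apply: sumr_ge0 => y _.
by rewrite !mulr_ge0// ?channel_ge0// simplex_ge0.
Qed.

Lemma channel_le1 X Y (W : channel R X Y) x y : W x y <= 1.
Proof. by case/andP: (channelP W) => /forallP/(_ x)/forallP/(_ y)/andP[]. Qed.

Lemma success_prob_le1 X Y m p (W : channel R X Y) (D : channel R Y 'I_m.+1) :
  success_prob p W D <= 1.
Proof.
rewrite -(simplex_sum1 p) /success_prob pair_big /=; apply: ler_sum => -[u x] _ /=.
rewrite -[leRHS]mulr1 -(channel_sum1 W x) mulr_sumr; apply: ler_sum => y _.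
by rewrite ler_piMr ?channel_le1// mulr_ge0 ?simplex_ge0 ?channel_ge0.
Qed.

Lemma det_is_channel X Y (f : X -> Y) :
  is_channel (fun x y => (y == f x)%:R : R).
Proof.
apply: is_channelP => [x y|x]; first exact: ler0n.
by rewrite (bigD1 (f x))//= eqxx big1 ?addr0// => y /negPf ->.
Qed.

Lemma Pc_has_sup X Y m p (W : channel R X Y) :
  has_sup [set success_prob p W D | D in [set: channel R Y 'I_m.+1]].
Proof.
split; last by exists 1 => _ [D _ <-]; exact: success_prob_le1.
pose D := Channel (det_is_channel (fun=> ord0 : 'I_m.+1) : is_channel (X := Y) _).
by exists (success_prob p W D); exists D.
Qed.

Lemma Pc_ge0 X Y m (p : simplex R ('I_m.+1 * X)%type) (W : channel R X Y) :
  0 <= Pc p W.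
Proof.
have [[_ [D _ _]] ub] := Pc_has_sup p W.
by rewrite (le_trans (success_prob_ge0 p W D))//; apply: ub_le_sup => //; exists D.
Qed.

Lemma Pc_le1 X Y m (p : simplex R ('I_m.+1 * X)%type) (W : channel R X Y) :
  Pc p W <= 1.
Proof.
have [ne _] := Pc_has_sup p W.
by apply: ge_sup => // _ [D _ <-]; exact: success_prob_le1.
Qed.

Lemma degraded_Pc X Y Z m (p : simplex R ('I_m.+1 * X)%type)
    (W : channel R X Y) (W' : channel R X Z) :
  degraded W' W -> Pc p W' <= Pc p W.
Proof.
move=> [V ->]; have [ne _] := Pc_has_sup p (channel_comp V W).
apply: ge_sup => // _ [D _ <-].
have [_ ub] := Pc_has_sup p W; apply: ub_le_sup => //.
exists (channel_comp D V) => //; apply: eq_bigr => u _; apply: eq_bigr => x _.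
rewrite /= /comp_fun.
under eq_bigr do rewrite mulr_sumr.
under [RHS]eq_bigr do rewrite mulr_sumr mulr_suml.
rewrite exchange_big /=; do 2 (apply: eq_bigr => ? _).
by ring.
Qed.

End noisiness.

Section noisiness_topology.
Variables (R : realType) (X : finType).
Implicit Types C : DMCo R X.

(* Independent of the representative, see [Pco_pi]. *)
Definition Pco m (p : simplex R ('I_m.+1 * X)%type) C : R :=
  Pc p (projT2 (repr C)).

Lemma Pco_pi m (p : simplex R ('I_m.+1 * X)%type) (W : DMC_star R X) :
  Pco p (\pi_(DMCo R X) W) = Pc p (projT2 W).
Proof.
have /eqquotP/asboolP[a b] : repr (\pi_(DMCo R X) W) = W %[mod DMCo R X].
  by rewrite reprK.
by apply/eqP; rewrite eq_le !degraded_Pc.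
Qed.

Definition Pco_gaps C1 C2 : set R := [set r |
  exists m (p : simplex R ('I_m.+1 * X)%type), r = `|Pco p C1 - Pco p C2|].

Definition noisiness_dist C1 C2 : R := sup (Pco_gaps C1 C2).

Lemma Pco_gaps_le1 C1 C2 : ubound (Pco_gaps C1 C2) 1.
Proof.
move=> _ [m [p ->]]; rewrite ler_norml.
have := Pc_ge0 p (projT2 (repr C1)); have := Pc_le1 p (projT2 (repr C1)).
have := Pc_ge0 p (projT2 (repr C2)); have := Pc_le1 p (projT2 (repr C2)).
by rewrite /Pco => *; apply/andP; split; lra.
Qed.

Lemma noisiness_dist_ub C1 C2 r : Pco_gaps C1 C2 r -> r <= noisiness_dist C1 C2.
Proof. by apply: ub_le_sup; exists 1; exact: Pco_gaps_le1. Qed.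

Lemma noisiness_dist_ge0 C1 C2 : 0 <= noisiness_dist C1 C2.
Proof.
have [g0|/set0P[r gr]] := eqVneq (Pco_gaps C1 C2) set0.
  by rewrite /noisiness_dist g0 sup0.
by rewrite (le_trans _ (noisiness_dist_ub gr))//; case: gr => m [p ->].
Qed.

Lemma noisiness_dist_le C1 C2 e : 0 <= e ->
  (forall m (p : simplex R ('I_m.+1 * X)%type), `|Pco p C1 - Pco p C2| <= e) ->
  noisiness_dist C1 C2 <= e.
Proof.
move=> e0 h; have [g0|/set0P ne] := eqVneq (Pco_gaps C1 C2) set0.
  by rewrite /noisiness_dist g0 sup0.
by apply: ge_sup => // _ [m [p ->]]; exact: h.
Qed.

Lemma noisiness_distxx C : noisiness_dist C C = 0.
Proof.
apply/eqP; rewrite eq_le noisiness_dist_ge0 andbT.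
by apply: noisiness_dist_le => // m p; rewrite subrr normr0.
Qed.

Lemma noisiness_dist_sym C1 C2 : noisiness_dist C1 C2 = noisiness_dist C2 C1.
Proof.
by congr sup; rewrite eqEsubset; split=> r [m [p ->]]; exists m, p; rewrite distrC.
Qed.

Lemma noisiness_dist_triangle C2 C1 C3 :
  noisiness_dist C1 C3 <= noisiness_dist C1 C2 + noisiness_dist C2 C3.
Proof.
apply: noisiness_dist_le => [|m p]; first by rewrite addr_ge0 ?noisiness_dist_ge0.
rewrite (le_trans (ler_distD (Pco p C2) _ _))// lerD// noisiness_dist_ub//;
  by exists m, p.
Qed.

Definition noisiness_ball C (e : R) : set (DMCo R X) :=
  [set C' | noisiness_dist C C' < e].

End noisiness_topology.

(* [noisiness_dist] separates points, but this plays no role in the topology it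
   induces; the pseudometric structure has the same open sets. *)
Definition noisiness_DMC (R : realType) (X : finType) : Type := DMCo R X.

Section noisiness_instance.
Variables (R : realType) (X : finType).
Local Notation T := (noisiness_DMC R X).

HB.instance Definition _ := Choice.on T.

Let ent : set_system (T * T) := entourage_ (@noisiness_ball R X).

Let ball_center (C : T) (e : R) : 0 < e -> noisiness_ball C e C.
Proof. by rewrite /noisiness_ball/= noisiness_distxx. Qed.

Let ball_sym (C C' : T) (e : R) : noisiness_ball C e C' -> noisiness_ball C' e C.
Proof. by rewrite /noisiness_ball/= noisiness_dist_sym. Qed.

Let ball_triangle (C1 C2 C3 : T) (e1 e2 : R) :
  noisiness_ball C1 e1 C2 -> noisiness_ball C2 e2 C3 ->
  noisiness_ball C1 (e1 + e2) C3.
Proof.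
move=> h1 h2; rewrite /noisiness_ball/=.
by rewrite (le_lt_trans (noisiness_dist_triangle C2 _ _))// ltrD.
Qed.

HB.instance Definition _ := hasNbhs.Build T (nbhs_ ent).

HB.instance Definition _ := @Nbhs_isPseudoMetric.Build R T ent erefl
  (@noisiness_ball R X) ball_center ball_sym ball_triangle erefl.

End noisiness_instance.

(* The nonemptiness proof makes the simplex inhabited, as the library requires
   of a measurable space. *)
Definition psimplex (R : realType) (X : finType) (X_gt0 : (0 < #|X|)%N) : Type :=
  simplex R X.

HB.instance Definition _ (R : realType) (X : finType) (X_gt0 : (0 < #|X|)%N) :=
  Topological.copy (psimplex R X_gt0) (set_type (prob_vectors R X)).
HB.instance Definition _ (R : realType) (X : finType) (X_gt0 : (0 < #|X|)%N) :=
  SubChoice.copy (psimplex R X_gt0) (set_type (prob_vectors R X)).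

Section uniform.
Variables (R : realType) (X : finType) (X_gt0 : (0 < #|X|)%N).

Definition uniform_fun (x : X) : R := #|X|%:R^-1.

Lemma card_neq0 : #|X|%:R != 0 :> R.
Proof. by rewrite pnatr_eq0 -lt0n. Qed.

Lemma uniform_prob_vectors : prob_vectors R X uniform_fun.
Proof.
split=> [x|]; first by rewrite invr_ge0 ler0n.
by rewrite sumr_const -[_ *+ _]mulr_natl mulfV// card_neq0.
Qed.

Definition uniform : psimplex R X_gt0 := SigSub (mem_set uniform_prob_vectors).

HB.instance Definition _ := isPointed.Build (psimplex R X_gt0) uniform.

End uniform.

Section blackwell.
Variables (R : realType) (X : finType) (X_gt0 : (0 < #|X|)%N).
Local Notation Delta := (psimplex R X_gt0).

Definition borel_simplex : measurableType (@open Delta).-sigma :=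
  g_sigma_algebraType (@open Delta).
Local Notation Borel := borel_simplex.

Definition MP : Type := probability Borel R.
HB.instance Definition _ := Choice.on MP.

Definition test_fun : Type := {f : Delta -> R | continuous f /\ bounded_fun f}.

(* The weak-* topology: the supremum of the initial topologies of the maps
   P |-> \int f dP is the coarsest one making them all continuous. *)
HB.instance Definition _ := Topological.copy MP
  (sup_topology (fun f : test_fun => Topological.class
    (initial_topology (fun P : probability Borel R => \int[P]_q sval f q)))).

(* The barycentre of M is computed coordinatewise. *)
Definition balanced (M : MP) : Prop :=
  forall x, \int[(M : probability Borel R)]_q (q : simplex R X) x = uniform_fun R x.

Definition msupport (M : MP) : set Delta :=
  [set q | forall U, open U -> U q -> (0 < (M : probability Borel R) U)%E].

Definition MP_bf : set MP := [set M | balanced M /\ finite_set (msupport M)].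

Section measure.
Variables (Y : finType) (W : channel R X Y).

(* The output distribution under the uniform input. *)
Definition Po (y : Y) : R := #|X|%:R^-1 * \sum_x W x y.

Definition posterior_fun (y : Y) (x : X) : R := W x y / (#|X|%:R * Po y).

(* Only used for y with Po y > 0; otherwise it takes a default value. *)
Definition posterior (y : Y) : Delta :=
  insubd (uniform R X_gt0) (posterior_fun y).

Definition blackwell_fun (A : set Borel) : \bar R :=
  (\sum_(y | (0 < Po y)%R) (Po y)%:E * \d_(posterior y : Borel) A)%E.

Lemma Po_ge0 y : 0 <= Po y.
Proof.
rewrite mulr_ge0 ?invr_ge0 ?ler0n//.
by apply: sumr_ge0 => x _; exact: channel_ge0.
Qed.

Lemma cardMPo y : #|X|%:R * Po y = \sum_x W x y.
Proof. by rewrite mulrA mulfV ?mul1r// card_neq0. Qed.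

Lemma Po_sum1 : \sum_y Po y = 1.
Proof.
rewrite -mulr_sumr exchange_big /=.
under eq_bigr do rewrite channel_sum1.
by rewrite sumr_const mulVf// card_neq0.
Qed.

Lemma posteriorE y x : 0 < Po y ->
  (posterior y : simplex R X) x = W x y / (#|X|%:R * Po y).
Proof.
move=> Py; rewrite /simplex_fun /posterior insubdK//; apply/mem_set; split=> [t|].
  by rewrite divr_ge0 ?channel_ge0// mulr_ge0 ?ler0n ?Po_ge0.
by rewrite -mulr_suml -cardMPo mulfV// mulf_neq0 ?card_neq0// gt_eqF.
Qed.

Let blackwell0 : blackwell_fun set0 = 0%E.
Proof. by rewrite /blackwell_fun big1// => y _; rewrite measure0 mule0. Qed.

Let blackwell_ge0 A : (0 <= blackwell_fun A)%E.
Proof. by apply: sume_ge0 => y Py; rewrite mule_ge0// lee_fin ltW. Qed.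

Let blackwell_sigma_additive : semi_sigma_additive blackwell_fun.
Proof.
move=> F mF tF mUF; rewrite [X in _ --> X](_ : _ =
    lim ((fun n => \sum_(0 <= i < n) blackwell_fun (F i))%E @ \oo)).
  by apply: is_cvg_ereal_nneg_natsum => k _; exact: blackwell_ge0.
rewrite nneseries_sum; last by move=> y j Py; rewrite mule_ge0// lee_fin ltW.
apply: eq_bigr => y Py; rewrite nneseriesZl//.
congr (_ * _)%E; apply/esym/cvg_lim => //; exact: measure_semi_sigma_additive.
Qed.

HB.instance Definition _ := isMeasure.Build _ _ _ blackwell_fun
  blackwell0 blackwell_ge0 blackwell_sigma_additive.

Let blackwell_setT : blackwell_fun setT = 1%E.
Proof.
rewrite /blackwell_fun.
under eq_bigr do rewrite diracT mule1.
rewrite sumEFin -Po_sum1 [in RHS](bigID (fun y => 0 < Po y))/= [X in _ + X]big1 ?addr0//.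
by move=> y; rewrite -leNgt => Py; apply/le_anti; rewrite Py Po_ge0.
Qed.

HB.instance Definition _ :=
  Measure_isProbability.Build _ _ _ blackwell_fun blackwell_setT.

Definition blackwell : MP := (blackwell_fun : probability Borel R).

Let part (y : Y) : {measure set Borel -> \bar R} :=
  mscale (NngNum (Po_ge0 y)) (\d_(posterior y : Borel)).

Let parts (n : nat) : {measure set Borel -> \bar R} :=
  if insub n is Some i then part (enum_val (i : 'I_#|Y|)) else mzero.

Lemma ge0_integral_blackwell (f : Borel -> \bar R) :
  (forall q, 0 <= f q)%E -> measurable_fun setT f ->
  (\int[blackwell_fun]_q f q =
   \sum_(y | (0 < Po y)%R) (Po y)%:E * f (posterior y))%E.
Proof.
move=> f0 mf; rewrite (@eq_measure_integral _ _ _ _ (msum parts #|Y|)).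
  rewrite ge0_integral_measure_sum//.
  rewrite (eq_bigr (fun k : 'I_#|Y| =>
    (Po (enum_val k))%:E * f (posterior (enum_val k)))%E); last first.
    move=> k _; rewrite /parts valK ge0_integral_mscale//= integral_dirac//.
    by rewrite diracT mul1e.
  rewrite -(big_enum_val (fun y => (Po y)%:E * f (posterior y))%E)/=.
  rewrite (bigID (fun y => 0 < Po y))/= [X in (_ + X)%E]big1 ?adde0//.
  move=> y; rewrite -leNgt => Py.
  by rewrite (_ : Po y = 0) ?mul0e//; apply/le_anti; rewrite Py Po_ge0.
move=> A mA _; apply/esym; rewrite -[RHS]/(blackwell_fun A) /blackwell_fun.
rewrite -[LHS]/(\sum_(k < #|Y|) parts k A)%E (eq_bigr (fun k : 'I_#|Y| =>
  (Po (enum_val k))%:E * \d_(posterior (enum_val k) : Borel) A)%E); last first.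
  by move=> k _; rewrite /parts valK.
rewrite -(big_enum_val (fun y => (Po y)%:E * \d_(posterior y : Borel) A)%E)/=.
rewrite (bigID (fun y => 0 < Po y))/= [X in (_ + X)%E]big1 ?adde0//.
move=> y; rewrite -leNgt => Py.
by rewrite (_ : Po y = 0) ?mul0e//; apply/le_anti; rewrite Py Po_ge0.
Qed.

End measure.

Lemma coord_continuous x : continuous (fun q : Delta => (q : simplex R X) x).
Proof.
move=> q; apply: (@continuous_comp Delta {ptws X -> R} R (@sval _ _) (proj x)).
  exact: initial_continuous.
exact: proj_continuous.
Qed.

Lemma continuous_measurable_Borel (f : Delta -> R) :
  continuous f -> measurable_fun setT (f : Borel -> R).
Proof.
move=> /continuousP cf; apply: (measurability _ (RGenOInfty.measurableE R)).
move=> _ [_ [a ->] <-]; rewrite setTI; apply: sub_sigma_algebra.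
exact/cf/interval_open.
Qed.

Lemma psimplex_hausdorff : hausdorff_space Delta.
Proof.
move=> p q pq; apply: val_inj; apply/funext => x.
apply: (@Rhausdorff R) => A B nA nB.
have [z [Az Bz]] := pq _ _ (coord_continuous (x := x) nA) (coord_continuous (x := x) nB).
by exists ((z : simplex R X) x).
Qed.

Lemma blackwell_balanced Y (W : channel R X Y) : balanced (blackwell W).
Proof.
move=> x; rewrite /Rintegral ge0_integral_blackwell//.
- rewrite (eq_bigr (fun y => (#|X|%:R^-1 * W x y)%:E)); last first.
    move=> y Py; rewrite posteriorE// -EFinM; congr EFin.
    by field; rewrite card_neq0//= gt_eqF.
  rewrite sumEFin /= -mulr_sumr /uniform_fun -[RHS]mulr1 -(channel_sum1 W x).
  congr (_ * _); rewrite [RHS](bigID (fun y => 0 < Po W y))/= [X in _ + X]big1 ?addr0//.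
  move=> y; rewrite -leNgt => Py; apply/le_anti; rewrite channel_ge0 andbT.
  have: Po W y = 0 by apply/le_anti; rewrite Py Po_ge0.
  move=> /(congr1 (fun t => #|X|%:R * t)); rewrite mulr0 cardMPo// => <-.
  by rewrite (bigD1 x)//= lerDl sumr_ge0// => ? _; exact: channel_ge0.
- by move=> q; rewrite lee_fin simplex_ge0.
- apply/measurable_EFinP; apply: continuous_measurable_Borel.
  exact: coord_continuous.
Qed.

Lemma blackwell_finite_support Y (W : channel R X Y) :
  finite_set (msupport (blackwell W)).
Proof.
apply: (@sub_finite_set _ _ [set posterior W y | y in [set: Y]]); last first.
  exact/finite_image/finite_finset.
set S := (X in _ `<=` X) => q; apply: contraPP => Sq /(_ (~` S)).
have fS : finite_set S by exact/finite_image/finite_finset.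
have oS : open (~` S).
  apply/closed_openC; move: S fS {Sq}; apply/accessible_finite_set_closed.
  exact/hausdorff_accessible/psimplex_hausdorff.
move=> /(_ oS Sq); rewrite /= /blackwell_fun big1 ?ltxx// => y _.
by rewrite diracE memNset ?mule0// => /(_ (imageT _ _)).
Qed.

Lemma blackwell_bf Y (W : channel R X Y) : MP_bf (blackwell W).
Proof. by split; [exact: blackwell_balanced|exact: blackwell_finite_support]. Qed.

Section invariance.
Implicit Types Y Z : finType.

Let mass Y (W : channel R X Y) y := \sum_x W x y.
Let post Y (W : channel R X Y) y x := W x y / mass W y.
Let energy Y (W : channel R X Y) := \sum_x \sum_y mass W y * post W y x ^+ 2.

Let mass_ge0 Y (W : channel R X Y) y : 0 <= mass W y.
Proof. by apply: sumr_ge0 => x _; exact: channel_ge0. Qed.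

Let mass_post Y (W : channel R X Y) y x : mass W y * post W y x = W x y.
Proof.
rewrite /post mulrCA; have [m0|m0] := eqVneq (mass W y) 0; last by rewrite mulfV ?mulr1.
rewrite m0 mul0r mulr0; apply/le_anti; rewrite channel_ge0 /= -m0 /mass.
by rewrite (bigD1 x)//= lerDl sumr_ge0// => ? _; exact: channel_ge0.
Qed.

Let mass_comp Y Z (V : channel R Y Z) (W : channel R X Y) z :
  mass (channel_comp V W) z = \sum_y V y z * mass W y.
Proof. by rewrite /mass exchange_big; apply: eq_bigr => y _; rewrite mulr_sumr. Qed.

Let energy_gap Y Z (V : channel R Y Z) (W : channel R X Y) :
  energy W - energy (channel_comp V W) = \sum_x \sum_z \sum_y
    V y z * mass W y * (post W y x - post (channel_comp V W) z x) ^+ 2.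
Proof.
rewrite /energy -sumrB; apply: eq_bigr => x _.
set q := post W ^~ x; set q' := post (channel_comp V W) ^~ x.
have E1 : \sum_z \sum_y V y z * mass W y * q y ^+ 2 = \sum_y mass W y * q y ^+ 2.
  rewrite exchange_big /=; apply: eq_bigr => y _.
  by rewrite -!mulr_suml channel_sum1 mul1r.
have E2 : \sum_z \sum_y V y z * mass W y * (q y * q' z) =
    \sum_z mass (channel_comp V W) z * q' z ^+ 2.
  apply: eq_bigr => z _; rewrite expr2 mulrA mass_post /= /comp_fun mulr_suml.
  by apply: eq_bigr => y _; rewrite -mass_post -/(q y); ring.
have E3 : \sum_z \sum_y V y z * mass W y * q' z ^+ 2 =
    \sum_z mass (channel_comp V W) z * q' z ^+ 2.
  by apply: eq_bigr => z _; rewrite -mulr_suml -mass_comp.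
transitivity (\sum_z \sum_y V y z * mass W y * q y ^+ 2
    - (\sum_z \sum_y V y z * mass W y * (q y * q' z)) *+ 2
    + \sum_z \sum_y V y z * mass W y * q' z ^+ 2); first by rewrite E1 E2 E3; ring.
rewrite -sumrMnl -sumrB -big_split /=; apply: eq_bigr => z _.
rewrite -sumrMnl -sumrB -big_split /=; apply: eq_bigr => y _.
by rewrite -/(q y) -/(q' z); ring.
Qed.

Let gap_ge0 Y Z (V : channel R Y Z) (W : channel R X Y) x z y :
  0 <= V y z * mass W y * (post W y x - post (channel_comp V W) z x) ^+ 2.
Proof.
by apply: mulr_ge0; [apply: mulr_ge0; [exact: channel_ge0|exact: mass_ge0]|exact: sqr_ge0].
Qed.

Let energy_degraded Y Z (W : channel R X Y) (W' : channel R X Z) :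
  degraded W' W -> energy W' <= energy W.
Proof.
move=> [V ->]; rewrite -subr_ge0 energy_gap.
by do 3 (apply: sumr_ge0 => ? _); exact: gap_ge0.
Qed.

Let blackwell_funE Y (W : channel R X Y) (A : set Borel) :
  blackwell_fun W A = (\sum_y Po W y * \1_A (posterior W y : Borel))%:E.
Proof.
rewrite -sumEFin [RHS](bigID (fun y => 0 < Po W y))/= [X in (_ + X)%E]big1 ?adde0//.
move=> y; rewrite -leNgt => Py.
by rewrite (_ : Po W y = 0) ?mul0r//; apply/le_anti; rewrite Py Po_ge0.
Qed.

Lemma blackwell_fun_equiv Y Z (W : channel R X Y) (W' : channel R X Z) :
  channel_equiv W W' -> blackwell_fun W = blackwell_fun W' :> (set Borel -> _).
Proof.
move=> [WW' W'W]; have := energy_degraded WW'; case: W'W => V -> le1.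
have gap0 x z y :
    V y z * mass W y * (post W y x - post (channel_comp V W) z x) ^+ 2 = 0.
  have /eqP : energy W - energy (channel_comp V W) = 0.
    apply/le_anti; rewrite subr_le0 le1 /= subr_ge0.
    by apply: energy_degraded; exists V.
  rewrite energy_gap psumr_eq0; last first.
    by move=> ? _; do 2 (apply: sumr_ge0 => ? _); exact: gap_ge0.
  move=> /allP/(_ x (mem_index_enum _)) /=; rewrite psumr_eq0; last first.
    by move=> ? _; apply: sumr_ge0 => ? _; exact: gap_ge0.
  move=> /allP/(_ z (mem_index_enum _)) /=; rewrite psumr_eq0; last first.
    by move=> ? _; exact: gap_ge0.
  by move=> /allP/(_ y (mem_index_enum _))/eqP.
have Pocomp z : Po (channel_comp V W) z = \sum_y V y z * Po W y.
  rewrite /Po -/(mass _ _) mass_comp mulr_sumr.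
  by apply: eq_bigr => y _; rewrite mulrCA.
apply/funext => A; rewrite !blackwell_funE; congr EFin.
under [RHS]eq_bigr do rewrite Pocomp mulr_suml.
rewrite exchange_big /=; apply: eq_bigr => y _.
rewrite -[LHS]mul1r -(channel_sum1 V y) mulr_suml; apply: eq_bigr => z _.
rewrite mulrA; have [->|VP0] := eqVneq (V y z * Po W y) 0; first by rewrite !mul0r.
suff -> : posterior W y = posterior (channel_comp V W) z by [].
congr insubd; apply/funext => x; rewrite /posterior_fun !cardMPo//.
apply/eqP; rewrite -subr_eq0 -sqrf_eq0.
have /eqP := gap0 x z y; rewrite mulf_eq0 => /orP[|//].
by rewrite /mass -cardMPo// mulrCA mulf_eq0 (negPf (card_neq0 _ _))// (negPf VP0).
Qed.

End invariance.

(* Independent of the representative, see [blackwell_class_pi]. *)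
Definition blackwell_class (C : DMCo R X) : MP_bf :=
  SigSub (mem_set (blackwell_bf (projT2 (repr C)))).

Lemma blackwell_class_pi (W : DMC_star R X) (A : set Borel) :
  (\val (blackwell_class (\pi_(DMCo R X) W)) : probability Borel R) A =
  blackwell_fun (projT2 W) A.
Proof.
rewrite [LHS](_ : _ = blackwell_fun (projT2 (repr (\pi_(DMCo R X) W))) A)//.
suff -> : blackwell_fun (projT2 (repr (\pi_(DMCo R X) W))) =
  blackwell_fun (projT2 W) :> (set Borel -> _) by [].
apply: blackwell_fun_equiv.
have /eqquotP/asboolP // : repr (\pi_(DMCo R X) W) = W %[mod DMCo R X].
by rewrite reprK.
Qed.

End blackwell.

(* The preimages of the open sets of MP_bf under [blackwell_class]; for a
   bijection this is transport of structure. A library measure is a function on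
   all sets, so distinct elements of [MP] may agree on every Borel set; the open
   sets of [MP] do not separate these, so taking preimages makes the topology
   insensitive to the distinction. *)
Definition weakstar_DMC (R : realType) (X : finType) (X_gt0 : (0 < #|X|)%N) : Type :=
  DMCo R X.

HB.instance Definition _ (R : realType) (X : finType) (X_gt0 : (0 < #|X|)%N) :=
  Topological.copy (weakstar_DMC R X_gt0)
    (initial_topology (@blackwell_class R X X_gt0)).

Definition weakstar_topology (R : realType) (X : finType) (X_gt0 : (0 < #|X|)%N) :
  set (set (DMCo R X)) := @open (weakstar_DMC R X_gt0).

Definition noisiness_topology (R : realType) (X : finType) :
  set (set (DMCo R X)) := @open (noisiness_DMC R X).

Arguments weakstar_topology R {X} X_gt0.
Arguments noisiness_topology : clear implicits.

(* Main.v *)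
(* For a channel W, Pc p W is |X| times the integral of a maximum of linear forms
   q |-> \sum_x p (u, x) q x against the Blackwell measure of W.
   These maxima are 1-Lipschitz and bounded by 1 uniformly in m and p, so a
   partition of unity on the compact simplex approximates all of them at once by
   combinations of finitely many continuous functions: weak-* neighbourhoods
   refine noisiness balls.  Conversely, up to scaling and adding a constant, every
   finite maximum of linear forms is such a payoff; differences of these maxima
   form a vector lattice that is uniformly dense in the continuous functions (a
   continuous function is approximated from below by a finite maximum of cones),
   so integrals of continuous functions are continuous for the noisiness
   distance. *)
Require Import Defs.
From mathcomp Require Import all_boot reals.
From mathcomp Require Import all_order all_algebra ring lra.
From mathcomp Require Import all_classical all_analysis measurable_realfun.
Import Order.TTheory GRing.Theory Num.Theory.
Import numFieldTopology.Exports numFieldNormedType.Exports.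

Set Implicit Arguments.
Unset Strict Implicit.
Unset Printing Implicit Defensive.

Local Open Scope classical_set_scope.
Local Open Scope ring_scope.

(** * Limits of finite sums and of absolute differences *)

Lemma cvg_fsum {R : realType} (I : finType) T (F : set_system T) (f : I -> T -> R) (l : I -> R) :
  Filter F -> (forall i, f i @ F --> l i) ->
  (fun t => \sum_i f i t) @ F --> \sum_i l i.
Proof.
move=> FF fl; elim: (index_enum I) => [|i s IH].
  under eq_cvg do rewrite big_nil; rewrite big_nil; exact: cvg_cst.
under eq_cvg do rewrite big_cons; rewrite big_cons; exact: cvgD.
Qed.

Lemma cvg_distl {R : realType} T (F : set_system T) (f : T -> R) (a l : R) :
  Filter F -> f @ F --> l -> (fun t => `|a - f t|) @ F --> `|a - l|.
Proof. by move=> FF fl; apply: cvg_norm; apply: cvgB => //; exact: cvg_cst. Qed.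

(** * Compactness of the simplex and its l1 distance *)

Section simplex.
Context {R : realType} {X : finType} {X_gt0 : (0 < #|X|)%N}.
Local Notation Delta := (psimplex R X_gt0).

Lemma prob_vectors_closed : closed (prob_vectors R X).
Proof.
have -> : prob_vectors R X =
    \bigcap_(x in setT) ((fun p : {ptws X -> R} => p x) @^-1` [set r | 0 <= r]) `&`
    ((fun p : {ptws X -> R} => \sum_x p x) @^-1` [set 1]).
  apply/seteqP; split => [p [p0 p1]|p [p0 p1]].
    by split => // x _; exact: p0.
  by split => // x; exact: p0.
apply: closedI.
  apply: closed_bigI => x _; apply: closed_comp; last exact: closed_ge.
  by move=> p _; exact: proj_continuous.
apply: closed_comp; last exact: closed_eq.
move=> p _.
apply: (@cvg_fsum R X _ (nbhs p) (fun x (q : {ptws X -> R}) => q x) p) => x.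
exact: (@proj_continuous X (fun=> R) x p).
Qed.

Lemma prob_vectors_compact : compact (prob_vectors R X).
Proof.
apply: (@subclosed_compact _ _ [set p : {ptws X -> R} | forall x, `[0, 1]%classic (p x)]).
- exact: prob_vectors_closed.
- apply: (@tychonoff X (fun=> R) (fun=> `[0, 1]%classic)) => x.
  exact: segment_compact.
- move=> p [p0 p1] x /=; rewrite in_itv /= p0 -p1 (bigD1 x) //= lerDl.
  by apply: sumr_ge0.
Qed.

(** Open sets of the subtype are traces of ambient open sets, so a cluster point of the image filter
    in [prob_vectors] is a cluster point of the filter itself. *)
Lemma psimplex_compact : compact [set: Delta].
Proof.
move=> F FF _.
have pF : ((val : Delta -> {ptws X -> R}) @ F) (prob_vectors R X).
  by apply: (@filterS _ F _ setT _ _ filterT) => q _; exact: set_valP.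
have [p [Ap clp]] := prob_vectors_compact _ pF.
exists (SigSub (mem_set Ap)); split=> // A B FA [_ [[B' oB' <-] B'p B'B]].
have [|_ [[q Aq <-] B'q]] := clp (val @` A) B' _ (open_nbhs_nbhs (conj oB' B'p)).
  by apply: (@filterS _ F _ A _ _ FA) => q Aq; exists q.
by exists q; split => //; exact: B'B.
Qed.

(** Compactness in the form used below: the centres of the subcover form a finite family, over which
    sums and maxima can be taken. *)
Lemma psimplex_finite_cover (U : Delta -> set Delta) :
  (forall s, open (U s)) -> (forall s, U s s) ->
  exists (I : finType) (c : I -> Delta), forall q, exists i, U (c i) q.
Proof.
move=> oU Us; have := psimplex_compact; rewrite compact_cover.
case/(_ Delta setT U) => [s _|q _|D _ cD]; first exact: oU.
  by exists q.
exists (seq_sub (finmap.enum_fset D)), (@ssval _ _) => q.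
by have [i Di Uq] := cD q I; exists (SeqSub Di).
Qed.

(** The simplex is covered by finitely many sets on which [f] stays within 1 of its value at a
    centre. *)
Lemma psimplex_bounded (f : Delta -> R) : continuous f ->
  exists2 B, 0 < B & forall q, `|f q| <= B.
Proof.
move=> cf; have [I [c Ic]] : exists (I : finType) (c : I -> Delta),
    forall q, exists i, `|f (c i) - f q| < 1.
  apply: (@psimplex_finite_cover (fun s => (fun q => `|f s - f q|) @^-1` [set r | r < 1])).
    move=> s; apply: open_comp; last exact: open_lt.
    by move=> q _; apply: (@cvg_distl R Delta (nbhs q) f); exact: cf.
  by move=> s /=; rewrite subrr normr0.
exists (1 + \sum_i `|f (c i)|) => [|q].
  by rewrite ltr_pwDl// sumr_ge0.
have [i fi] := Ic q; rewrite (bigD1 i)//= addrA ler_wpDr ?sumr_ge0//.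
rewrite -lerBlDr (le_trans _ (ltW fi))// (le_trans (lerB_dist _ _))// distrC//.
Qed.

Lemma continuous_bounded_fun (f : Delta -> R) : continuous f -> bounded_fun f.
Proof.
move=> /psimplex_bounded[B B0 fB]; exists B; split; first exact: num_real.
by move=> M BM q _ /=; rewrite (le_trans (fB q))// ltW.
Qed.

(** The l1 distance suits both directions: forms with coefficients in [0,1] are 1-Lipschitz for it,
    and it is itself a sum of maxima of two linear forms in [q]. *)
Definition ldist (p q : Delta) : R :=
  \sum_x `|(p : simplex R X) x - (q : simplex R X) x|.

Lemma ldistxx p : ldist p p = 0.
Proof. by rewrite /ldist big1// => x _; rewrite subrr normr0. Qed.

Lemma ldist_ge0 p q : 0 <= ldist p q.
Proof. exact: sumr_ge0. Qed.

Lemma ldist_eq0 (s t : Delta) : ldist s t = 0 -> s = t.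
Proof.
move=> /eqP; rewrite psumr_eq0// => /allP st0; apply: val_inj; apply/funext => x.
by apply/eqP; rewrite -subr_eq0 -normr_eq0; exact: st0 (mem_index_enum x).
Qed.

Lemma ldist_continuous p : continuous (ldist p).
Proof.
move=> q; apply: (@cvg_fsum R X Delta (nbhs q) (fun x (r : Delta) =>
  `|(p : simplex R X) x - (r : simplex R X) x|)) => x.
apply: (@cvg_distl R Delta (nbhs q) (fun r : Delta => (r : simplex R X) x)).
exact: Defs.coord_continuous.
Qed.

End simplex.

(** * Pointwise maxima of finite families *)

Definition is_fmax (R : realType) (U : finType) T (F : U -> T -> R) (g : T -> R) :=
  (forall u t, F u t <= g t) /\ (forall t, exists u, g t = F u t).

Lemma fmax_exists (R : realType) (U : finType) T (F : U -> T -> R) (u0 : U) :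
  exists g, is_fmax F g.
Proof.
exists (fun t => F [arg max_(u > u0) F u t]%O t).
by split=> [u t|t]; [case: arg_maxP => // v _; apply|eexists].
Qed.

(** * Averages against the Blackwell measure and the guessing probability *)

Section mean.
Context {R : realType} {X : finType} {X_gt0 : (0 < #|X|)%N}.
Local Notation Delta := (psimplex R X_gt0).
Implicit Types (Y : finType) (f g : Delta -> R).

Definition linear_form (a : X -> R) (q : Delta) : R := \sum_x a x * (q : simplex R X) x.

(* When Po W y = 0 the posterior is a junk value, with weight 0. *)
Definition mean Y (W : channel R X Y) f := \sum_y Po W y * f (posterior X_gt0 W y).

Lemma mean_le Y (W : channel R X Y) f g :
  (forall q, f q <= g q) -> mean W f <= mean W g.
Proof. by move=> fg; apply: ler_sum => y _; rewrite ler_wpM2l ?Po_ge0. Qed.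

Lemma meanD Y (W : channel R X Y) f g :
  mean W (fun q => f q + g q) = mean W f + mean W g.
Proof. by rewrite -big_split; apply: eq_bigr => y _; rewrite mulrDr. Qed.

Lemma meanZ Y (W : channel R X Y) k f :
  mean W (fun q => k * f q) = k * mean W f.
Proof. by rewrite mulr_sumr; apply: eq_bigr => y _; rewrite mulrCA. Qed.

Lemma meanB Y (W : channel R X Y) f g :
  mean W (fun q => f q - g q) = mean W f - mean W g.
Proof. by rewrite -sumrB; apply: eq_bigr => y _; rewrite mulrBr. Qed.

Lemma mean_sum Y (W : channel R X Y) (I : finType) (F : I -> Delta -> R) :
  mean W (fun q => \sum_i F i q) = \sum_i mean W (F i).
Proof. by rewrite exchange_big; apply: eq_bigr => y _; rewrite mulr_sumr. Qed.

Lemma mean_cst Y (W : channel R X Y) c : mean W (fun=> c) = c.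
Proof. by rewrite /mean -mulr_suml Po_sum1// mul1r. Qed.

Lemma eq_mean Y (W : channel R X Y) f g : f =1 g -> mean W f = mean W g.
Proof. by move=> fg; apply: eq_bigr => y _; rewrite fg. Qed.

(** Averaging is monotone and fixes constants, hence contracts the uniform distance. *)
Lemma mean_dist Y (W : channel R X Y) f g e :
  (forall q, `|f q - g q| <= e) -> `|mean W f - mean W g| <= e.
Proof.
move=> fg; rewrite -meanB ler_norml -{1}(mean_cst W (- e)) -{2}(mean_cst W e).
by rewrite !mean_le// => q; have := fg q; rewrite ler_norml => /andP[].
Qed.

(** The formula [ge0_integral_blackwell] covers nonnegative functions, so the positive and negative
    parts are integrated separately and recombined. *)
Lemma Rintegral_blackwell Y (W : channel R X Y) f : continuous f ->
  \int[blackwell X_gt0 W : probability (borel_simplex R X_gt0) R]_q f q = mean W f.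
Proof.
move=> cf; have mf : measurable_fun setT (EFin \o f : borel_simplex R X_gt0 -> _).
  by apply/measurable_EFinP; exact: continuous_measurable_Borel.
rewrite /Rintegral integralE !ge0_integral_blackwell//; first last.
- exact: measurable_funepos.
- exact: measurable_funeneg.
have E (h : Delta -> R) :
    (\sum_(y | (0 < Po W y)%R) (Po W y)%:E * (h (posterior X_gt0 W y))%:E)%E = (mean W h)%:E.
  under eq_bigr do rewrite -EFinM.
  rewrite sumEFin; congr EFin; rewrite /mean [RHS](bigID (fun y => 0 < Po W y))/=.
  rewrite [X in _ + X]big1 ?addr0// => y; rewrite -leNgt => Py.
  by rewrite (_ : Po W y = 0) ?mul0r//; apply/le_anti; rewrite Py Po_ge0.
rewrite (eq_bigr (fun y => (Po W y)%:E * (f^\+ (posterior X_gt0 W y))%:E)%E); last first.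
  by move=> y _; rewrite funeposE /= /funrpos EFin_max.
rewrite [X in (_ - X)%E](eq_bigr (fun y =>
  (Po W y)%:E * (f^\- (posterior X_gt0 W y))%:E)%E); last first.
  by move=> y _; rewrite funenegE /= /funrneg EFin_max.
rewrite !E -EFinB /= -meanB; apply: eq_mean => q.
by rewrite /funrpos /funrneg /= /Order.max; case: ifPn; case: ifPn => ? ?; lra.
Qed.

Lemma Po_posterior Y (W : channel R X Y) y x :
  #|X|%:R * (Po W y * (posterior X_gt0 W y : simplex R X) x) = W x y.
Proof.
have : 0 <= Po W y := Po_ge0 _ _; rewrite le_eqVlt => /predU1P[P0|Py].
  rewrite -P0 mul0r mulr0; apply/le_anti; rewrite channel_ge0 /=.
  move: P0 => /(congr1 (fun t => #|X|%:R * t)); rewrite mulr0 cardMPo// => ->.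
  by rewrite (bigD1 x)//= lerDl sumr_ge0// => ? _; exact: channel_ge0.
by rewrite posteriorE//; field; rewrite card_neq0// gt_eqF.
Qed.

(** The decoder can be optimised separately at each output [y], where the best guess maximises the
    linear form at the posterior of [y]. *)
Lemma Pc_mean Y (W : channel R X Y) m (p : simplex R ('I_m.+1 * X)%type) g :
  is_fmax (fun u => linear_form (fun x => p (u, x))) g ->
  Pc p W = #|X|%:R * mean W g.
Proof.
case=> gub gmax.
have E u y : \sum_x p (u, x) * W x y =
    #|X|%:R * (Po W y * linear_form (fun x => p (u, x)) (posterior X_gt0 W y)).
  rewrite !mulr_sumr; apply: eq_bigr => x _; rewrite -Po_posterior; ring.
have S (D : channel R Y 'I_m.+1) :
    success_prob p W D = \sum_y \sum_u D y u * \sum_x p (u, x) * W x y.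
  rewrite /success_prob; under eq_bigr do rewrite exchange_big.
  rewrite exchange_big; do 2 (apply: eq_bigr => ? _); rewrite mulr_sumr.
  by apply: eq_bigr => x _; ring.
have [ne ub] := Pc_has_sup p W; apply/le_anti/andP; split.
  apply: ge_sup => // _ [D _ <-]; rewrite S mulr_sumr; apply: ler_sum => y _.
  rewrite -[leRHS]mul1r -{1}(channel_sum1 D y) mulr_suml; apply: ler_sum => u _.
  rewrite ler_wpM2l ?channel_ge0// E; rewrite ler_wpM2l ?ler0n//.
  by rewrite ler_wpM2l ?Po_ge0.
(* The maximum a posteriori decoder [h] is deterministic and attains the bound. *)
have /choice[h hE] : forall y, exists u, g (posterior X_gt0 W y) =
    linear_form (fun x => p (u, x)) (posterior X_gt0 W y).
  by move=> y; exact: gmax.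
apply: ub_le_sup => //; exists (Channel (det_is_channel h)) => //.
rewrite S mulr_sumr; apply: eq_bigr => y _.
rewrite (bigD1 (h y))//= eqxx mul1r [X in _ + X]big1 ?addr0; last first.
  by move=> u /negPf uh; rewrite uh mul0r.
by rewrite E hE.
Qed.

End mean.

(** * The weak-* topology described by averages of continuous functions *)

Section topology.
Context {R : realType} {X : finType} {X_gt0 : (0 < #|X|)%N}.
Local Notation Delta := (psimplex R X_gt0).
Implicit Types f : Delta -> R.

(** For continuous [f] this is the integral against the Blackwell measure of the class, see
    [cmeanE]. *)
Definition cmean f (C : DMCo R X) := mean (projT2 (repr C)) f.

Lemma cmeanE f C : continuous f ->
  cmean f C = \int[\val (blackwell_class X_gt0 C) : probability (borel_simplex R X_gt0) R]_q f q.
Proof. by move=> cf; exact: esym (Rintegral_blackwell (projT2 (repr C)) cf). Qed.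

(** By compactness [f] is bounded, hence a test function, and the supremum topology refines the
    initial topology of its integral. *)
Lemma MP_integral_continuous f : continuous f ->
  continuous (fun P : MP R X_gt0 => \int[P : probability (borel_simplex R X_gt0) R]_q f q).
Proof.
move=> cf; pose ft : test_fun R X_gt0 := exist _ f (conj cf (continuous_bounded_fun cf)).
move=> P A nA.
have /cvg_sup : nbhs (P : MP R X_gt0) --> (P : MP R X_gt0) by [].
move=> /(_ ft); apply.
exact: (@initial_continuous (probability (borel_simplex R X_gt0) R) R
  (fun P => \int[P]_q sval ft q) P A nA).
Qed.

Lemma blackwell_class_continuous :
  continuous (fun C : weakstar_DMC R X_gt0 => \val (blackwell_class X_gt0 C) : MP R X_gt0).
Proof.
move=> C; apply: (@continuous_comp (weakstar_DMC R X_gt0) (@MP_bf R X X_gt0)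
  (MP R X_gt0) (@blackwell_class R X X_gt0) \val); exact: initial_continuous.
Qed.

Lemma cmean_weakstar_continuous f : continuous f ->
  continuous (cmean f : weakstar_DMC R X_gt0 -> R).
Proof.
move=> cf.
have -> : (cmean f : weakstar_DMC R X_gt0 -> R) =
    (fun P : MP R X_gt0 => \int[P : probability (borel_simplex R X_gt0) R]_q f q)
    \o (fun C => \val (blackwell_class X_gt0 C)).
  by apply/funext => C; rewrite /= cmeanE.
move=> C; apply: (@continuous_comp (weakstar_DMC R X_gt0) (MP R X_gt0) R
  (fun C => \val (blackwell_class X_gt0 C))).
  exact: blackwell_class_continuous.
exact: MP_integral_continuous.
Qed.

(** Universal property of the weak-* topology, through its layers: initial for [blackwell_class],
    then the subspace [MP_bf], then a supremum of initial topologies over the test functions. *)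
Lemma weakstar_continuous (T : topologicalType) (F : T -> weakstar_DMC R X_gt0) :
  (forall f, continuous f -> continuous (fun t => cmean f (F t))) -> continuous F.
Proof.
move=> cF; apply: continuous_comp_initial; apply: continuous_comp_initial => t.
apply/cvg_sup => -[f [cf bf]].
apply: (@continuous_comp_initial _ _ _ (fun P : MP R X_gt0 =>
  \int[P : probability (borel_simplex R X_gt0) R]_q f q)
  (fun t => \val (blackwell_class X_gt0 (F t)) : MP R X_gt0)).
rewrite (_ : _ \o _ = fun t => cmean f (F t)); first exact: cF.
by apply/funext => s; rewrite cmeanE.
Qed.
End topology.

(** * Noisiness balls are weak-* neighbourhoods *)

Section noisiness_coarser.
Context {R : realType} {X : finType} {X_gt0 : (0 < #|X|)%N}.
Local Notation Delta := (psimplex R X_gt0).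

Lemma partition_of_unity (e : R) : 0 < e ->
  exists (I : finType) (c : I -> Delta) (phi : I -> Delta -> R),
  [/\ forall i, continuous (phi i), forall i q, 0 <= phi i q,
      forall q, \sum_i phi i q = 1 & forall i q, e <= ldist (c i) q -> phi i q = 0].
Proof.
move=> e0; have [I [c Ic]] : exists (I : finType) (c : I -> Delta),
    forall q, exists i, ldist (c i) q < e.
  apply: (@psimplex_finite_cover _ _ _ (fun s => ldist s @^-1` [set r | r < e])) => s.
    by apply: open_comp; [move=> q _; exact: ldist_continuous|exact: open_lt].
  by rewrite /= ldistxx.
(* Twice the positive part of [e - ldist (c i) q]: a bump that vanishes outside the ball of radius
   [e]. The bumps are then normalised by their sum. *)
pose b i (q : Delta) := (e - ldist (c i) q) + `|e - ldist (c i) q|.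
have b0 i q : 0 <= b i q.
  by rewrite -lerBlDl sub0r -normrN; exact: ler_norm.
have bs0 q : 0 < \sum_i b i q.
  have [i di] := Ic q; rewrite (bigD1 i)//= ltr_pwDl ?sumr_ge0//.
  by rewrite /b ltr_wpDr// subr_gt0.
have bc i : continuous (b i).
  move=> q; apply: (@cvgD _ _ _ (nbhs q) _ (fun q => e - ldist (c i) q)).
    by apply: cvgB; [exact: cvg_cst|exact: ldist_continuous].
  by apply: (@cvg_distl R Delta (nbhs q) (ldist (c i))); exact: ldist_continuous.
exists I, c, (fun i q => b i q / \sum_j b j q); split.
- move=> i q; apply: (cvgM (bc i q)).
  apply: (@cvgV _ _ (nbhs q) _ (fun q => \sum_j b j q)); first by rewrite gt_eqF.
  by apply: (@cvg_fsum R I Delta (nbhs q) b) => j; exact: bc.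
- by move=> i q; rewrite divr_ge0// ltW.
- by move=> q; rewrite -mulr_suml mulfV// gt_eqF.
- move=> i q; rewrite -subr_le0 => h; rewrite /b ler0_norm// subrr mul0r//.
Qed.

Lemma simplex_le1 (T : finType) (r : simplex R T) t : r t <= 1.
Proof.
by rewrite -(simplex_sum1 r) (bigD1 t)//= lerDl sumr_ge0// => ? _; exact: simplex_ge0.
Qed.

Section guess.
Variables (m : nat) (p : simplex R ('I_m.+1 * X)%type) (g : Delta -> R).
Hypothesis gmax : is_fmax (fun u => linear_form (fun x => p (u, x))) g.

Lemma guess_norm_le1 q : `|g q| <= 1.
Proof.
have [u ->] := gmax.2 q; rewrite ger0_norm.
  rewrite -(simplex_sum1 (q : simplex R X)); apply: ler_sum => x _.
  by rewrite ler_piMl ?simplex_ge0 ?simplex_le1.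
by apply: sumr_ge0 => x _; rewrite mulr_ge0 ?simplex_ge0.
Qed.

(** The form that attains the maximum at one point bounds [g] from below at the other, and its
    coefficients lie in [0,1]. The constant 1 does not depend on [m] and [p]. *)
Lemma guess_lipschitz q r : `|g q - g r| <= ldist q r.
Proof.
have H s t : g s - g t <= ldist s t.
  have [u ->] := gmax.2 s; apply: le_trans (lerB (lexx _) (gmax.1 u t)) _.
  rewrite -sumrB; apply: ler_sum => x _; rewrite -mulrBr.
  apply: le_trans (ler_norm _) _; rewrite normrM ler_piMl//.
  by rewrite ger0_norm ?simplex_ge0 ?simplex_le1.
have S s t : ldist s t = ldist t s by apply: eq_bigr => x _; rewrite distrC.
by rewrite ler_norml H andbT lerNl opprB S H.
Qed.

End guess.

Lemma noisiness_ball_weakstar_nbhs (C : DMCo R X) (e : R) : 0 < e ->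
  nbhs (C : weakstar_DMC R X_gt0) (noisiness_ball C e).
Proof.
move=> e0; pose n : R := #|X|%:R.
have n0 : 0 < n by rewrite ltr0n.
(* Three errors of size [d], scaled by [n], give 3e/4, which is below [e]. *)
pose d := e / (4 * n).
have d0 : 0 < d by rewrite divr_gt0// mulr_gt0.
have [I [c [phi [phic phi0 phi1 phiN]]]] := partition_of_unity d0.
(* The added 1 keeps [k] positive; the [#|I|] errors [d / k] then sum to at most [d]. *)
pose k : R := #|I|%:R + 1.
have k0 : 0 < k by rewrite ltr_wpDl.
pose Cw : weakstar_DMC R X_gt0 := C.
have : \forall C' \near nbhs Cw, forall i, `|cmean (phi i) C - cmean (phi i) C'| < d / k.
  apply: (@filter_forall (weakstar_DMC R X_gt0) I
    (fun i => [set C' | `|cmean (phi i) C - cmean (phi i) C'| < d / k]) (nbhs Cw)) => i.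
  have cc : cmean (phi i) @ nbhs Cw --> cmean (phi i) C.
    exact: cmean_weakstar_continuous.
  by apply: (@cvgr_dist_lt _ _ _ _ _ _ _ cc); rewrite divr_gt0.
apply: filterS => C' CC'; rewrite /noisiness_ball /=.
suff : noisiness_dist C C' <= n * (3 * d).
  move/le_lt_trans; apply.
  rewrite /d; have -> : n * (3 * (e / (4 * n))) = 3 / 4 * e.
    by field; rewrite gt_eqF.
  lra.
apply: noisiness_dist_le => [|m p]; first by apply/ltW/mulr_gt0 => //; exact/mulr_gt0.
have [g gmax] := fmax_exists
  (fun u (q : Delta) => linear_form (fun x => p (u, x)) q) ord0.
rewrite /Pco !(Pc_mean _ gmax) -mulrBr normrM gtr0_norm// ler_pM2l//.
(* Interpolation of [g] from its values at the centres. Only the coefficients, bounded by 1, depend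
   on [m] and [p], so one neighbourhood serves all of them. *)
pose h q := \sum_i g (c i) * phi i q.
have gh q : `|g q - h q| <= d.
  rewrite -[g q]mulr1 -(phi1 q) mulr_sumr -sumrB.
  apply: le_trans (ler_norm_sum _ _ _) _.
  rewrite -[leRHS]mulr1 -(phi1 q) mulr_sumr; apply: ler_sum => i _.
  rewrite -mulrBl normrM (ger0_norm (phi0 _ _)).
  (* Where [phi i] does not vanish, [q] is within [d] of [c i], and [g] is 1-Lipschitz. *)
  have [/phiN ->|/ltW ld] := leP d (ldist (c i) q); first by rewrite !mulr0.
  by rewrite ler_wpM2r// distrC (le_trans (guess_lipschitz gmax _ _)).
have mh : `|cmean h C - cmean h C'| <= d.
  rewrite /cmean /h !mean_sum -sumrB; apply: le_trans (ler_norm_sum _ _ _) _.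
  apply: (@le_trans _ _ (\sum_(i : I) d / k)).
    apply: ler_sum => i _; rewrite !meanZ -mulrBr normrM -[leRHS]mul1r.
    by rewrite ler_pM//; [exact: (guess_norm_le1 gmax)|exact/ltW/CC'].
  rewrite sumr_const -[_ *+ _]mulr_natl mulrCA ler_piMr ?ltW//.
  by rewrite ltr_pdivrMr// mul1r ltrDl.
have gC := mean_dist (projT2 (repr C)) gh.
have gC' := mean_dist (projT2 (repr C')) gh.
move: gC gC' mh; rewrite /cmean !ler_norml => /andP[? ?] /andP[? ?] /andP[? ?].
by apply/andP; split; lra.
Qed.
End noisiness_coarser.

(** * Averages of continuous functions are continuous for the noisiness distance *)

Section weakstar_coarser.
Context {R : realType} {X : finType} {X_gt0 : (0 < #|X|)%N}.
Local Notation Delta := (psimplex R X_gt0).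
Implicit Types (a b : X -> R) (q : Delta) (f g h : Delta -> R).

Definition convex_pl g :=
  exists (U : finType) (a : U -> X -> R), is_fmax (fun u => linear_form (a u)) g.

Lemma linear_formD a b q :
  linear_form (fun x => a x + b x) q = linear_form a q + linear_form b q.
Proof. by rewrite -big_split; apply: eq_bigr => x _; rewrite mulrDl. Qed.

(** Coordinates sum to 1, so on the simplex affine functions are linear forms. *)
Lemma linear_form_cst c q : linear_form (fun=> c) q = c.
Proof. by rewrite /linear_form -mulr_sumr simplex_sum1 mulr1. Qed.

Lemma convex_pl_linear a : convex_pl (linear_form a).
Proof. by exists unit, (fun=> a); split => // q; exists tt. Qed.

Lemma convex_plD g h : convex_pl g -> convex_pl h -> convex_pl (g \+ h).
Proof.
move=> [U [a [ag aE]]] [V [b [bh bE]]].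
exists (U * V)%type, (fun w x => a w.1 x + b w.2 x); split => [w q|q].
  by rewrite linear_formD lerD.
have [u gu] := aE q; have [v hv] := bE q.
by exists (u, v); rewrite /= linear_formD gu hv.
Qed.

Lemma convex_pl_max g h :
  convex_pl g -> convex_pl h -> convex_pl (fun q => Num.max (g q) (h q)).
Proof.
move=> [U [a [ag aE]]] [V [b [bh bE]]].
exists (U + V)%type, (fun w => match w with inl u => a u | inr v => b v end).
split => [[u|v] q|q]; rewrite ?le_max ?ag ?bh ?orbT//.
have [u gu] := aE q; have [v hv] := bE q.
by case: leP => _; [exists (inr v)|exists (inl u)].
Qed.

(** Differences of convex piecewise linear functions: unlike the convex ones, they are closed under
    negation. *)
Definition dc_pl f := exists g h,
  [/\ convex_pl g, convex_pl h & forall q, f q = g q - h q].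

Lemma dc_pl_linear a : dc_pl (linear_form a).
Proof.
exists (linear_form a), (linear_form (fun=> 0)).
by split; [exact: convex_pl_linear..|move=> q; rewrite linear_form_cst subr0].
Qed.

Lemma dc_plD f g : dc_pl f -> dc_pl g -> dc_pl (fun q => f q + g q).
Proof.
move=> [f1 [f2 [cf1 cf2 fE]]] [g1 [g2 [cg1 cg2 gE]]].
exists (f1 \+ g1), (f2 \+ g2); split; [exact: convex_plD..|].
by move=> q /=; rewrite fE gE opprD addrACA.
Qed.

Lemma dc_plN f : dc_pl f -> dc_pl (fun q => - f q).
Proof.
move=> [f1 [f2 [cf1 cf2 fE]]]; exists f2, f1; split => // q.
by rewrite fE opprB.
Qed.

(** max(f1 - f2, g1 - g2) = max(f1 + g2, g1 + f2) - (f2 + g2). *)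
Lemma dc_pl_max f g : dc_pl f -> dc_pl g -> dc_pl (fun q => Num.max (f q) (g q)).
Proof.
move=> [f1 [f2 [cf1 cf2 fE]]] [g1 [g2 [cg1 cg2 gE]]].
exists (fun q => Num.max ((f1 \+ g2) q) ((g1 \+ f2) q)), (f2 \+ g2); split.
- by apply: convex_pl_max; exact: convex_plD.
- exact: convex_plD.
- move=> q /=; rewrite fE gE; case: leP => h1; case: leP => h2; lra.
Qed.

Lemma dc_pl_sum (I : finType) (F : I -> Delta -> R) :
  (forall i, dc_pl (F i)) -> dc_pl (fun q => \sum_i F i q).
Proof.
move=> cF; elim: (index_enum I) => [|i s IH].
  have [g [h [cg ch E]]] := dc_pl_linear (fun=> 0).
  by exists g, h; split=> // q; rewrite big_nil -E linear_form_cst.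
have [g [h [cg ch E]]] := dc_plD (cF i) IH.
by exists g, h; split=> // q; rewrite big_cons -E.
Qed.

Lemma dc_pl_bigmax (I : finType) (F : I -> Delta -> R) (i0 : I) :
  (forall i, dc_pl (F i)) -> dc_pl (fun q => \big[Num.max/F i0 q]_i F i q).
Proof.
move=> cF; elim: (index_enum I) => [|i s IH].
  have [g [h [cg ch E]]] := cF i0.
  by exists g, h; split=> // q; rewrite big_nil.
have [g [h [cg ch E]]] := dc_pl_max (cF i) IH.
by exists g, h; split=> // q; rewrite big_cons -E.
Qed.

Lemma dc_pl_cone (s : Delta) (c K : R) : 0 <= K ->
  dc_pl (fun q => c - K * ldist s q).
Proof.
move=> K0.
(* On the simplex the form inside is [K * (s x - q x)]; its maximum with its opposite is the
   absolute value. *)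
have Kdist : dc_pl (fun q : Delta => \sum_x
    Num.max (linear_form (fun t => K * (s : simplex R X) x - K * (t == x)%:R) q)
          (- linear_form (fun t => K * (s : simplex R X) x - K * (t == x)%:R) q)).
  by apply: dc_pl_sum => x; apply: dc_pl_max; [|apply: dc_plN]; exact: dc_pl_linear.
have [g [h [cg ch E]]] := dc_plD (dc_pl_linear (fun=> c)) (dc_plN Kdist).
exists g, h; split => // q; rewrite -E linear_form_cst; congr (_ - _).
rewrite mulr_sumr; apply: eq_bigr => x _.
rewrite linear_formD linear_form_cst.
have -> : linear_form (fun t => - (K * (t == x)%:R)) q = - (K * (q : simplex R X) x).
  rewrite /linear_form (bigD1 x)//= eqxx mulr1 mulNr big1 ?addr0//.
  by move=> t /negPf ->; rewrite mulr0 oppr0 mul0r.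
rewrite -mulrBr -{1}(ger0_norm K0) -normrM.
by case: ler0P => h0; [rewrite max_r//|rewrite max_l//]; lra.
Qed.

Lemma dc_pl_dense f e : continuous f -> 0 < e ->
  exists2 g : Delta -> R, dc_pl g & forall q, `|f q - g q| <= e.
Proof.
move=> cf e0; have [B B0 fB] := psimplex_bounded cf.
have e20 : 0 < e / 2 by rewrite divr_gt0.
have /choice[G GP] : forall s : Delta, exists G : Delta -> R,
    [/\ dc_pl G, continuous G, forall q, G q <= f q & G s = f s - e / 2].
  (* The cone with apex (s, f s - e / 2) lies below f once it is steep enough,
     and by compactness finitely many local slopes suffice. *)
  move=> s.
  have /choice[n nP] : forall t : Delta, exists n : R,
      0 <= n /\ f s - e / 2 < f t + n * ldist s t.
    move=> t; have [st|st] := eqVneq (ldist s t) 0.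
      by exists 0; rewrite (ldist_eq0 st) mul0r; split => //; lra.
    have st0 : 0 < ldist s t by rewrite lt_def st ldist_ge0.
    (* This slope raises [f t] by 2B, hence to at least B, which bounds [f s]. *)
    exists ((B + B) / ldist s t); split; first by rewrite divr_ge0 ?addr_ge0 ?ltW.
    rewrite divfK//; have := fB s; have := fB t.
    by rewrite !ler_norml => /andP[? ?] /andP[? ?]; lra.
  have [I [c Ic]] : exists (I : finType) (c : I -> Delta),
      forall q, exists i, f s - e / 2 < f q + n (c i) * ldist s q.
    apply: (@psimplex_finite_cover _ _ _ (fun t =>
      (fun q => f q + n t * ldist s q) @^-1` [set r | f s - e / 2 < r])) => t.
      apply: open_comp; last exact: open_gt.
      move=> q _; apply: (cvgD (cf q)); apply: cvgMr; exact: ldist_continuous.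
    exact: (nP t).2.
  have N0 : 0 <= \sum_i n (c i) by apply: sumr_ge0 => i _; exact: (nP _).1.
  (* The sum of the nonnegative local slopes dominates each of them. *)
  exists (fun q => f s - e / 2 - (\sum_i n (c i)) * ldist s q); split.
  - exact: dc_pl_cone.
  - move=> q; apply: (@cvgB _ _ _ (nbhs q) _ (fun=> f s - e / 2)).
      exact: cvg_cst.
    by apply: cvgMr; exact: ldist_continuous.
  - move=> q; rewrite lerBlDr; have [i /ltW fi] := Ic q; apply: le_trans fi _.
    rewrite lerD2l ler_wpM2r ?ldist_ge0// (bigD1 i)//= lerDl.
    by apply: sumr_ge0 => j _; exact: (nP _).1.
  - by rewrite ldistxx mulr0 subr0.
(* At its apex a cone is e/2 below [f], so it stays less than [e] below nearby; the maximum of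
   finitely many cones does so everywhere. *)
have [I [c Ic]] : exists (I : finType) (c : I -> Delta),
    forall q, exists i, f q - G (c i) q < e.
  apply: (@psimplex_finite_cover _ _ _
    (fun s => (fun q => f q - G s q) @^-1` [set r | r < e])) => s.
    apply: open_comp; last exact: open_lt.
    have [_ Gc _ _] := GP s.
    by move=> q _; exact: (cvgB (cf q) (Gc q)).
  have [_ _ _ Gs] := GP s; rewrite /= Gs; lra.
(* Any point of the simplex yields an index, which serves as the default of the maximum. *)
have [i0 _] := Ic (uniform R X_gt0).
exists (fun q => \big[Num.max/G (c i0) q]_i G (c i) q).
  by apply: dc_pl_bigmax => i; have [] := GP (c i).
move=> q; rewrite ger0_norm; last first.
  by rewrite subr_ge0; apply/bigmax_leP; split => [|i _];
    [have [_ _ Gf _] := GP (c i0)|have [_ _ Gf _] := GP (c i)]; exact: Gf.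
have [i /ltW fi] := Ic q; apply: le_trans _ fi.
by rewrite lerB// le_bigmax.
Qed.

Lemma noisiness_dist_bound C1 C2 m (p : simplex R ('I_m.+1 * X)%type) :
  `|Pco p C1 - Pco p C2| <= noisiness_dist C1 C2.
Proof. by apply: noisiness_dist_ub; exists m, p. Qed.

(** Guessing probabilities are indexed by ['I_m.+1]; the index type is nonempty because the maximum
    is attained at some index. *)
Lemma convex_pl_ord g : convex_pl g ->
  exists m (a : 'I_m.+1 -> X -> R), is_fmax (fun u => linear_form (a u)) g.
Proof.
move=> [U [a [ag aE]]]; have [u0 _] := aE (uniform R X_gt0).
have cU : #|U| = #|U|.-1.+1 by rewrite prednK//; apply/card_gt0P; exists u0.
exists #|U|.-1, (fun i => a (enum_val (cast_ord (esym cU) i))); split => [u q|q].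
  exact: ag.
have [u ->] := aE q; exists (cast_ord cU (enum_rank u)).
by rewrite cast_ord_comp cast_ord_id enum_rankK.
Qed.

(** Shifting the coefficients makes them positive and dividing by their total [S] makes them a
    distribution [p], so the average of [g] is an affine function of [Pco p]. *)
Lemma convex_pl_lipschitz g : convex_pl g ->
  exists2 S, 0 < S & forall C1 C2, `|cmean g C1 - cmean g C2| <= S * noisiness_dist C1 C2.
Proof.
move=> /convex_pl_ord[m [a [ag aE]]].
(* The sum dominates every [- a u x]; the 1 makes the shifted coefficients strictly positive, so
   that [S] is nonzero. *)
pose c := 1 + \sum_u \sum_x `|a u x|.
pose b u x := a u x + c.
have b0 u x : 0 < b u x.
  have : - a u x <= \sum_u \sum_x `|a u x|.
    apply: le_trans (ler_norm _) _; rewrite normrN (bigD1 u)//= (bigD1 x)//= -addrA lerDl.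
    by rewrite addr_ge0// sumr_ge0// => ? _; exact: sumr_ge0.
  by rewrite /b /c; lra.
have [x0 _] : exists x0 : X, x0 \in X by apply/card_gt0P.
pose S := \sum_(w : 'I_m.+1 * X) b w.1 w.2.
have S0 : 0 < S.
  rewrite /S (bigD1 (ord0, x0))//= ltr_pwDl// sumr_ge0// => w _; exact: ltW.
have pP : prob_vectors R _ (fun w : 'I_m.+1 * X => b w.1 w.2 / S).
  split=> [w|]; first by rewrite divr_ge0// ltW.
  by rewrite -mulr_suml mulfV// gt_eqF.
pose p : simplex R ('I_m.+1 * X)%type := SigSub (mem_set pP).
have pE u q : linear_form (fun x => p (u, x)) q = S^-1 * (linear_form (a u) q + c).
  rewrite -(linear_form_cst c q) -linear_formD mulr_sumr; apply: eq_bigr => x _.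
  by rewrite mulrA; congr (_ * _); rewrite mulrC.
have gp : is_fmax (fun u => linear_form (fun x => p (u, x)))
    (fun q => S^-1 * (g q + c)).
  split=> [u q|q]; first by rewrite pE ler_pM2l ?invr_gt0// lerD2r.
  by have [u E] := aE q; exists u; rewrite pE E.
have n0 : 0 < #|X|%:R :> R by rewrite ltr0n.
exists (S / #|X|%:R) => [|C1 C2]; first by rewrite divr_gt0.
have gE C : cmean g C = S / #|X|%:R * Pco p C - c.
  rewrite /Pco (Pc_mean _ gp) meanZ meanD mean_cst /cmean.
  by field; rewrite !gt_eqF.
rewrite !gE opprB addrA subrK -mulrBr normrM gtr0_norm ?divr_gt0// ler_pM2l ?divr_gt0//.
exact: noisiness_dist_bound.
Qed.

Lemma cmean_noisiness_continuous f : continuous f ->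
  continuous (cmean f : noisiness_DMC R X -> R).
Proof.
move=> cf C; apply/(@cvgrPdist_le _ _ _ (nbhs C) (nbhs_filter C) (cmean f)) => e e0.
have e40 : 0 < e / 4 by rewrite divr_gt0.
have [g [g1 [g2 [cg1 cg2 gE]]] fg] := dc_pl_dense cf e40.
have [S1 S10 H1] := convex_pl_lipschitz cg1.
have [S2 S20 H2] := convex_pl_lipschitz cg2.
(* With this radius the average of [g] moves by less than e/4; approximating [f] by [g] at both
   classes costs e/4 each. *)
have d0 : 0 < e / (4 * (S1 + S2)) by rewrite divr_gt0// mulr_gt0// addr_gt0.
apply: filterS (nbhsx_ballx (C : noisiness_DMC R X) _ d0) => C' CC'.
have {}CC' : noisiness_dist C C' * (S1 + S2) < e / 4.
  rewrite -ltr_pdivlMr ?addr_gt0//; apply: lt_le_trans CC' _.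
  by rewrite invfM mulrA.
have := mean_dist (projT2 (repr C)) fg; have := mean_dist (projT2 (repr C')) fg.
have := H1 C C'; have := H2 C C'.
have E D : mean (projT2 (repr D)) g = cmean g1 D - cmean g2 D.
  by rewrite -meanB; exact: eq_mean.
rewrite !E -/(cmean f C) -/(cmean f C').
move: CC'; rewrite !ler_norml => ? /andP[? ?] /andP[? ?] /andP[? ?] /andP[? ?].
by apply/andP; split; lra.
Qed.
End weakstar_coarser.

Theorem theorem5 (R : realType) (X : finType) (X_gt0 : (0 < #|X|)%N) :
  weakstar_topology R X_gt0 = noisiness_topology R X.
Proof.
apply/seteqP; split=> [A oA|A oA].
  (* Weak-* open sets are noisiness open because the identity is continuous. *)
  have /continuousP : continuous (id : noisiness_DMC R X -> weakstar_DMC R X_gt0).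
    by apply: weakstar_continuous => f cf; exact: cmean_noisiness_continuous.
  exact.
rewrite /weakstar_topology openE => C AC.
have /nbhs_ballP[e e0 eA] : nbhs (C : noisiness_DMC R X) A by exact: open_nbhs_nbhs.
exact: filterS eA (noisiness_ball_weakstar_nbhs C e0).
Qed.
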